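(* Let $p,q,k\ge 1$ be integers with $\gcd(p,q)=1$. Let $G=\langle a,b\mid a^{p}=b^{q}\rangle$ and let $1\ne a^{kp}\in Z(G)$, so that $$\Gamma_{k}:=G/\langle a^{kp}\rangle\cong\langle S,U\mid S^{kp}=U^{kq}=1,\ S^{p}=U^{q}\rangle\cong \mathbb{Z}/kp *_{\mathbb{Z}/k}\mathbb{Z}/kq .$$ Then the trivial $\mathbb{Z}\Gamma_k$-module $\mathbb{Z}$ has a free resolution, $2$-periodic in degrees $\ge 1$, of the form $$\cdots\xrightarrow{\partial_2}\mathbb{Z}\Gamma_k^{2}\xrightarrow{\partial_3}\mathbb{Z}\Gamma_k^{2}\xrightarrow{\partial_2}\mathbb{Z}\Gamma_k^{2}\xrightarrow{\partial_1}\mathbb{Z}\Gamma_k\xrightarrow{\varepsilon}\mathbb{Z}\to 0,$$ where the differential in every even degree $\ge2$ is $\partial_2$, the differential in every odd degree $\ge3$ is $\partial_3$, and $$\partial_1=\begin{bmatrix} S-1 \\ U-1 \end{bmatrix},\quad \partial_2=\begin{bmatrix} \mathbf N_S^{kp-1} & 0 \\ \mathbf N_S^{p-1} & -\mathbf N_U^{q-1} \end{bmatrix},\quad \partial_3=\begin{bmatrix} S-1 & 0 \\ U-1 & (1-U)\mathbf N_{U^q}^{k-1} \end{bmatrix}.$$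
   Context: All modules are left modules. A map of free modules $A^{r}\to A^{s}$ over a ring $A$ is represented by an $r\times s$ matrix acting on the right of row vectors. For a group element $g$ and an integer $m\ge0$, $\mathbf N_g^{m}:=\sum_{i=0}^{m}g^i$ in the integral group ring. $\varepsilon$ is the augmentation map. *)

(* Defs.v *)
From HB Require Import structures.
From mathcomp Require Import all_boot all_order all_algebra.
From mathcomp Require Import finmap monalg.
From mathcomp Require Import boolp.
From mathcomp Require Import generic_quotient.

Set Implicit Arguments.
Unset Strict Implicit.
Unset Printing Implicit Defensive.

Import GRing.Theory Num.Theory.

Local Open Scope quotient_scope.
Local Open Scope group_scope.

Record normal_subgroup (G : groupType) := NormalSubgroup {
  normal_pred : {pred G};
  normal_group : group_closed normal_pred;
  normal_conj : forall x y, x \in normal_pred -> x ^ y \in normal_pred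
}.

Section Quotient.
Variables (G : groupType) (N : normal_subgroup G).

Local Notation inN x := (x \in normal_pred N).

Definition coset_rel (x y : G) : bool := inN (x * y^-1).

Lemma coset_rel_refl : reflexive coset_rel.
Proof. by move=> x; rewrite /coset_rel mulgV; case: (normal_group N). Qed.

Lemma coset_rel_imp x y : coset_rel x y -> coset_rel y x.
Proof.
move=> h; have := group_closedV (normal_group N) h.
by rewrite invgM invgK.
Qed.

Lemma coset_rel_sym : symmetric coset_rel.
Proof. by move=> x y; apply/idP/idP; apply: coset_rel_imp. Qed.

Lemma coset_rel_trans : transitive coset_rel.
Proof.
move=> y x z hxy hyz; have := group_closedM (normal_group N) hxy hyz.
by rewrite -mulgA mulKg.
Qed.

Canonical coset_equiv :=
  EquivRel coset_rel coset_rel_refl coset_rel_sym coset_rel_trans.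

Definition quotient_group := {eq_quot coset_rel}.

HB.instance Definition _ := Choice.on quotient_group.
HB.instance Definition _ := EqQuotient.on quotient_group.

Lemma cosetP (x y : G) :
  reflect (\pi_quotient_group x = \pi_quotient_group y) (inN (x * y^-1)).
Proof. exact: eqquotP. Qed.

Definition qmul (x y : quotient_group) : quotient_group :=
  \pi_quotient_group (repr x * repr y).
Definition qinv (x : quotient_group) : quotient_group :=
  \pi_quotient_group (repr x)^-1.
Definition qone : quotient_group := \pi_quotient_group 1.

Lemma inN_repr x : inN (repr (\pi_quotient_group x) * x^-1).
Proof. by apply/cosetP; rewrite reprK. Qed.

Lemma qmulE x y :
  qmul (\pi_quotient_group x) (\pi_quotient_group y)
  = \pi_quotient_group (x * y).
Proof.
apply/cosetP; set x' := repr _; set y' := repr _.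
have hx : inN (x' * x^-1) := inN_repr x.
have hy : inN (y' * y^-1) := inN_repr y.
have hy' := normal_conj x'^-1 hy.
have -> : x' * y' * (x * y)^-1 = (y' * y^-1) ^ x'^-1 * (x' * x^-1).
  by rewrite conjgE invgK invgM !mulgA mulgVK.
exact: group_closedM (normal_group N) _ _ hy' hx.
Qed.

Lemma qinvE x :
  qinv (\pi_quotient_group x) = \pi_quotient_group x^-1.
Proof.
apply/cosetP; rewrite invgK; set x' := repr _.
have hx : inN (x * x'^-1) by apply/cosetP; rewrite reprK.
have := normal_conj x hx.
by rewrite conjgE -mulgA mulKg.
Qed.

Lemma quotW (P : quotient_group -> Prop) :
  (forall x, P (\pi_quotient_group x)) -> forall x, P x.
Proof. by move=> h x; rewrite -[x]reprK; apply: h. Qed.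

Lemma qmulA : associative qmul.
Proof.
elim/quotW=> x; elim/quotW=> y; elim/quotW=> z.
by rewrite !qmulE mulgA.
Qed.

Lemma qmul1 : left_id qone qmul.
Proof. by elim/quotW=> x; rewrite qmulE mul1g. Qed.

Lemma qmul1r : right_id qone qmul.
Proof. by elim/quotW=> x; rewrite qmulE mulg1. Qed.

Lemma qmulV : left_inverse qone qinv qmul.
Proof. by elim/quotW=> x; rewrite qinvE qmulE mulVg. Qed.

Lemma qmulVr : right_inverse qone qinv qmul.
Proof. by elim/quotW=> x; rewrite qinvE qmulE mulgV. Qed.

HB.instance Definition _ :=
  isGroup.Build quotient_group qmulA qmul1 qmul1r qmulV qmulVr.

Definition gproj (x : G) : quotient_group := \pi_quotient_group x.

Lemma gprojM : {morph gproj : x y / x * y}.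
Proof. by move=> x y; rewrite [RHS]qmulE. Qed.

HB.instance Definition _ := monoid.isMultiplicative.Build G quotient_group gproj gprojM.

Lemma gproj1 : gproj 1 = 1. Proof. by []. Qed.

HB.instance Definition _ :=
  Multiplicative_isUMagmaMorphism.Build G quotient_group gproj gproj1.

Lemma gproj_eq x y : (gproj x = gproj y) <-> inN (x * y^-1).
Proof. by split=> /cosetP. Qed.

Lemma gproj_surj (y : quotient_group) : exists x, y = gproj x.
Proof. by exists (repr y); rewrite /gproj reprK. Qed.

End Quotient.

Arguments gproj {G N} x.

Section Generated.
Variables (G : groupType) (A : G -> Prop).

Definition gen : {pred G} := fun x =>
  `[< forall H : {pred G}, group_closed H ->
        (forall a, A a -> a \in H) -> x \in H >].

Lemma gen_group : group_closed gen.
Proof.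
split=> [|x y /asboolP hx /asboolP hy]; apply/asboolP=> H gH hH.
  by case: gH.
by case: (gH) => _; apply; [apply: hx|apply: hy].
Qed.

Lemma mem_gen a : A a -> a \in gen.
Proof. by move=> ha; apply/asboolP=> H _; apply. Qed.

Definition ncl : {pred G} := fun x =>
  `[< forall N : normal_subgroup G,
        (forall a, A a -> a \in normal_pred N) -> x \in normal_pred N >].

Lemma ncl_group : group_closed ncl.
Proof.
split=> [|x y /asboolP hx /asboolP hy]; apply/asboolP=> N hN.
  by case: (normal_group N).
by case: (normal_group N) => _; apply; [apply: hx|apply: hy].
Qed.

Lemma ncl_conj x y : x \in ncl -> x ^ y \in ncl.
Proof.
by move=> /asboolP hx; apply/asboolP=> N hN; apply: normal_conj; apply: hx.
Qed.

Definition normal_closure : normal_subgroup G :=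
  NormalSubgroup ncl_group ncl_conj.

Lemma mem_ncl a : A a -> a \in ncl.
Proof. by move=> ha; apply/asboolP=> N; apply. Qed.

End Generated.

Definition central (G : groupType) (z : G) : Prop := forall x, commute z x.

Section CentralCycle.
Variables (G : groupType) (z : G) (zC : central z).

Local Notation cycle := (gen (fun x => x = z)).

Lemma cycle_central x : x \in cycle -> central x.
Proof.
move=> /asboolP hx.
suff : x \in ((fun y => `[< central y >]) : {pred G}) by move/asboolP.
apply: hx => [|_ ->]; last exact/asboolP.
split=> [|u v /asboolP hu /asboolP hv]; apply/asboolP=> y.
  by rewrite /commute mul1g mulg1.
by apply: commute_sym; apply: commuteM; [|apply: commuteV]; apply: commute_sym.
Qed.

Lemma cycle_conj x y : x \in cycle -> x ^ y \in cycle.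
Proof.
by move=> hx; rewrite conjgE mulgA -(cycle_central hx) mulgVK.
Qed.

Definition central_cycle : normal_subgroup G :=
  NormalSubgroup (gen_group (fun x => x = z)) cycle_conj.

End CentralCycle.

Section FreeGroup.
Variable X : choiceType.

(* The letter (x, false) stands for x, the letter (x, true) for x^-1. *)
Definition letter := (X * bool)%type.
Definition flip (l : letter) : letter := (l.1, ~~ l.2).
Definition winv (w : seq letter) : seq letter := rev [seq flip l | l <- w].

Inductive word_eqv : seq letter -> seq letter -> Prop :=
| word_refl w : word_eqv w w
| word_sym w1 w2 : word_eqv w1 w2 -> word_eqv w2 w1
| word_trans w2 w1 w3 : word_eqv w1 w2 -> word_eqv w2 w3 -> word_eqv w1 w3
| word_cancel u v l : word_eqv (u ++ l :: flip l :: v) (u ++ v).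

Lemma word_catl u w1 w2 : word_eqv w1 w2 -> word_eqv (u ++ w1) (u ++ w2).
Proof.
elim=> [w|v1 v2 _ h|v2 v1 v3 _ h1 _ h2|u' v l].
- exact: word_refl.
- exact: word_sym.
- exact: word_trans h1 h2.
- by rewrite !catA; apply: word_cancel.
Qed.

Lemma word_catr u w1 w2 : word_eqv w1 w2 -> word_eqv (w1 ++ u) (w2 ++ u).
Proof.
elim=> [w|v1 v2 _ h|v2 v1 v3 _ h1 _ h2|u' v l].
- exact: word_refl.
- exact: word_sym.
- exact: word_trans h1 h2.
- by rewrite -!catA; apply: word_cancel.
Qed.

Lemma word_cat u1 u2 w1 w2 :
  word_eqv u1 u2 -> word_eqv w1 w2 -> word_eqv (u1 ++ w1) (u2 ++ w2).
Proof.
by move=> hu hw; apply: word_trans (word_catr _ hu) (word_catl _ hw).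
Qed.

Lemma flipK : involutive flip.
Proof. by case=> x b; rewrite /flip /= negbK. Qed.

Lemma winv_cat u v : winv (u ++ v) = winv v ++ winv u.
Proof. by rewrite /winv map_cat rev_cat. Qed.

Lemma winvK : involutive winv.
Proof.
move=> w; rewrite /winv map_rev revK -map_comp -[RHS]map_id.
by apply: eq_map => l; exact: flipK.
Qed.

Lemma winv_eqv w1 w2 : word_eqv w1 w2 -> word_eqv (winv w1) (winv w2).
Proof.
elim=> [w|v1 v2 _ h|v2 v1 v3 _ h1 _ h2|u v l].
- exact: word_refl.
- exact: word_sym.
- exact: word_trans h1 h2.
- have -> : winv (u ++ l :: flip l :: v) = winv v ++ l :: flip l :: winv u.
    by rewrite winv_cat -(cat1s l) -(cat1s (flip l)) !winv_cat /winv /= flipK -!catA.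
  by rewrite winv_cat; apply: word_cancel.
Qed.

Lemma word_mulV w : word_eqv (w ++ winv w) [::].
Proof.
elim/last_ind: w => [|w l ih]; first exact: word_refl.
rewrite -cats1 winv_cat /winv /= -!catA /=.
exact: word_trans (word_cancel _ _ _) ih.
Qed.

Definition word_rel (w1 w2 : seq letter) : bool := `[< word_eqv w1 w2 >].

Lemma word_rel_refl : reflexive word_rel.
Proof. by move=> w; apply/asboolP/word_refl. Qed.

Lemma word_rel_sym : symmetric word_rel.
Proof.
by move=> u v; apply/idP/idP=> /asboolP h; apply/asboolP/word_sym.
Qed.

Lemma word_rel_trans : transitive word_rel.
Proof.
by move=> v u w /asboolP h1 /asboolP h2; apply/asboolP/(word_trans h1 h2).
Qed.

Canonical word_equiv :=
  EquivRel word_rel word_rel_refl word_rel_sym word_rel_trans.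

Definition free_group := {eq_quot word_rel}.

HB.instance Definition _ := Choice.on free_group.
HB.instance Definition _ := EqQuotient.on free_group.

Lemma wordP (u v : seq letter) :
  (\pi_free_group u = \pi_free_group v) <-> word_eqv u v.
Proof.
by split=> [/eqquotP/asboolP|h] //; apply/eqquotP/asboolP.
Qed.

Definition fmul (x y : free_group) : free_group :=
  \pi_free_group (repr x ++ repr y).
Definition finv (x : free_group) : free_group := \pi_free_group (winv (repr x)).
Definition fone : free_group := \pi_free_group [::].

Lemma repr_eqv w : word_eqv (repr (\pi_free_group w)) w.
Proof. by apply/wordP; rewrite reprK. Qed.

Lemma fmulE u v :
  fmul (\pi_free_group u) (\pi_free_group v) = \pi_free_group (u ++ v).
Proof. by apply/wordP; apply: word_cat; apply: repr_eqv. Qed.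

Lemma finvE u : finv (\pi_free_group u) = \pi_free_group (winv u).
Proof. by apply/wordP; apply: winv_eqv; apply: repr_eqv. Qed.

Lemma freeW (P : free_group -> Prop) :
  (forall w, P (\pi_free_group w)) -> forall x, P x.
Proof. by move=> h x; rewrite -[x]reprK; apply: h. Qed.

Lemma fmulA : associative fmul.
Proof.
elim/freeW=> x; elim/freeW=> y; elim/freeW=> z.
by rewrite !fmulE catA.
Qed.

Lemma fmul1 : left_id fone fmul.
Proof. by elim/freeW=> x; rewrite fmulE. Qed.

Lemma fmul1r : right_id fone fmul.
Proof. by elim/freeW=> x; rewrite fmulE cats0. Qed.

Lemma fmulVr : right_inverse fone finv fmul.
Proof. by elim/freeW=> x; rewrite finvE fmulE; apply/wordP/word_mulV. Qed.

Lemma fmulV : left_inverse fone finv fmul.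
Proof.
elim/freeW=> x; rewrite finvE fmulE; apply/wordP.
by rewrite -{2}[x]winvK; apply: word_mulV.
Qed.

HB.instance Definition _ := isGroup.Build free_group fmulA fmul1 fmul1r fmulV fmulVr.

Definition fgen (x : X) : free_group := \pi_free_group [:: (x, false)].

Lemma free_ind (P : free_group -> Prop) :
  P 1 -> (forall x y, P y -> P (fgen x * y)) ->
  (forall x y, P y -> P ((fgen x)^-1 * y)) -> forall y, P y.
Proof.
move=> h1 hM hV; elim/freeW; elim=> [//|[x b] w ih].
have -> : \pi_free_group ((x, b) :: w) =
    (if b then (fgen x)^-1 else fgen x) * \pi_free_group w.
  by case: b; rewrite /fgen ?[_^-1]finvE [RHS]fmulE.
by case: b; [apply: hV|apply: hM].
Qed.

End FreeGroup.

Arguments fgen {X} x.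

Section Presentation.
Variables (X : choiceType) (R : free_group X -> Prop).

Definition presented : groupType := quotient_group (normal_closure R).

Definition pgen (x : X) : presented := gproj (fgen x).

Lemma pres_rel r : R r -> gproj r = 1 :> presented.
Proof.
move=> hr; rewrite -(gproj1 (normal_closure R)); apply/gproj_eq.
by rewrite invg1 mulg1; apply: mem_ncl.
Qed.

Lemma pres_ind (P : presented -> Prop) :
  P 1 -> (forall x y, P y -> P (pgen x * y)) ->
  (forall x y, P y -> P ((pgen x)^-1 * y)) -> forall y, P y.
Proof.
move=> h1 hM hV y; have [w ->] := gproj_surj y.
elim/free_ind: w => [//|x w ih|x w ih]; rewrite gmulfM.
  exact: hM.
by rewrite gmulfV; apply: hV.
Qed.

Lemma pres_central (z : presented) :
  (forall x, commute z (pgen x)) -> central z.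
Proof.
move=> h; elim/pres_ind=> [|x y ih|x y ih]; first exact: commute1.
  by apply: commuteM.
by apply: commuteM => //; apply: commuteV.
Qed.

End Presentation.

Arguments pgen {X} R x.

Section Amalgam.
Variables (A B C : groupType) (f : C -> A) (g : C -> B).

Let inA (a : A) : free_group (A + B)%type := fgen (inl a).
Let inB (b : B) : free_group (A + B)%type := fgen (inr b).

(* All elements of A and B are taken as generators: the first two families of
   relators, the multiplication tables, present the free product A * B, and the
   third one amalgamates the images of C. *)
Inductive amalgam_relator : free_group (A + B)%type -> Prop :=
| amalgam_mulA a1 a2 : amalgam_relator (inA a1 * inA a2 * (inA (a1 * a2))^-1)
| amalgam_mulB b1 b2 : amalgam_relator (inB b1 * inB b2 * (inB (b1 * b2))^-1)
| amalgam_glue c : amalgam_relator (inA (f c) * (inB (g c))^-1).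

Definition amalgam : groupType := presented amalgam_relator.

Definition amalgam_inl (a : A) : amalgam := pgen amalgam_relator (inl a).
Definition amalgam_inr (b : B) : amalgam := pgen amalgam_relator (inr b).

End Amalgam.

Arguments amalgam_inl {A B C} f g a.
Arguments amalgam_inr {A B C} f g b.

(* Z/n for n >= 1, with its additive group law written multiplicatively;
   unlike 'Z_n, this is the trivial group for n = 1. *)
Definition cyc (n : nat) := 'I_n.-1.+1.
HB.instance Definition _ n := Group.on (cyc n).

Definition cyc_gen (n : nat) : cyc n := inZp 1.

Definition cyc_embed (k m : nat) (x : cyc k) : cyc (k * m) := inZp (m * x).

Lemma cyc_embedM k m : {morph @cyc_embed k m : x y / x * y}.
Proof.
move=> x y; apply: val_inj => /=; rewrite modnDm -mulnDr.
case: k x y => [|k] x y /=.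
  by rewrite mul0n !modn1.
case: m => [|m]; first by rewrite !mul0n.
have -> : ((k.+1 * m.+1).-1.+1 = k.+1 * m.+1)%N by rewrite mulSn addSn.
by rewrite muln_modr [X in (_ %% X %% _)%N]mulnC modn_mod.
Qed.

HB.instance Definition _ k m :=
  monoid.isMultiplicative.Build (cyc k) (cyc (k * m)) (@cyc_embed k m)
    (@cyc_embedM k m).

Lemma cyc_embed_inj k m : 0 < k -> 0 < m -> injective (@cyc_embed k m).
Proof.
case: k => // k _ m_gt0 x y /(congr1 val) /=.
case: m m_gt0 => // m _.
have -> : ((k.+1 * m.+1).-1.+1 = k.+1 * m.+1)%N by rewrite mulSn addSn.
rewrite ![(m.+1 * _)%N]mulnC -!muln_modl !modn_small ?ltn_ord // => /eqP.
by rewrite eqn_pmul2r // => /eqP/val_inj.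
Qed.

Section GroupRing.
Variable G : groupType.

Local Open Scope fset_scope.
Local Open Scope ring_scope.

(* In monalg's notation << c *g g >> is the element c g. The ring structure of
   monalg does not apply: it requires a monoid without nontrivial units. *)
Definition group_ring := {malg int[G]}.

HB.instance Definition _ := GRing.Zmodule.on group_ring.

Implicit Types x y z : group_ring.

Definition grmul x y : group_ring :=
  \sum_(g <- msupp x) \sum_(h <- msupp y) << x@_g * y@_h *g (g * h)%g >>.

Definition grone : group_ring := << 1 *g 1%g >>.

Lemma grmulw (d1 d2 : {fset G}) x y :
  msupp x `<=` d1 -> msupp y `<=` d2 ->
  grmul x y = \sum_(g <- d1) \sum_(h <- d2) << x@_g * y@_h *g (g * h)%g >>.
Proof.
move=> le_d1 le_d2; rewrite /grmul (big_fset_incl _ le_d1) /=.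
  apply/eq_bigr=> k1 _; apply/big_fset_incl => // k _ /mcoeff_outdom ->.
  by rewrite mulr0 monalgU0.
move=> k _ /mcoeff_outdom xk.
by rewrite big1 => // k' _; rewrite xk mul0r monalgU0.
Qed.

Lemma grmulUU c d g h :
  grmul << c *g g >> << d *g h >> = << c * d *g (g * h)%g >>.
Proof. by rewrite (grmulw msuppU_le msuppU_le) !big_seq_fset1 !mcoeffUU. Qed.

Lemma grmulDl : left_distributive grmul +%R.
Proof.
move=> x y z; have sz := fsubset_refl (msupp z).
rewrite (grmulw (msuppD_le x y) sz) (grmulw (fsubsetUl _ (msupp y)) sz).
rewrite (grmulw (fsubsetUr (msupp x) _) sz) -big_split /=.
apply/eq_bigr=> g _; rewrite -big_split /=; apply/eq_bigr=> h _.
by rewrite mcoeffD mulrDl monalgUD.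
Qed.

Lemma grmulDr : right_distributive grmul +%R.
Proof.
move=> z x y; have sz := fsubset_refl (msupp z).
rewrite (grmulw sz (msuppD_le x y)) (grmulw sz (fsubsetUl _ (msupp y))).
rewrite (grmulw sz (fsubsetUr (msupp x) _)) -big_split /=.
apply/eq_bigr=> g _; rewrite -big_split /=; apply/eq_bigr=> h _.
by rewrite mcoeffD mulrDr monalgUD.
Qed.

Lemma grmul0l : left_zero 0 grmul.
Proof. by move=> x; rewrite /grmul msupp0 big_seq_fset0. Qed.

Lemma grmul0r : right_zero 0 grmul.
Proof.
by move=> x; rewrite /grmul msupp0 big1 // => g _; rewrite big_seq_fset0.
Qed.

Lemma group_ring_ind (P : group_ring -> Prop) :
  P 0 -> (forall x y, P x -> P y -> P (x + y)) ->
  (forall c g, P << c *g g >>) -> forall x, P x.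
Proof. by move=> h0 hD hU x; rewrite [x]monalgE; apply: big_ind. Qed.

Lemma grmulA : associative grmul.
Proof.
elim/group_ring_ind=> [|x1 x2 h1 h2|c g] y z; rewrite ?grmul0l //.
  by rewrite !grmulDl h1 h2.
elim/group_ring_ind: y => [|y1 y2 h1 h2|d h]; rewrite ?(grmul0l, grmul0r) //.
  by rewrite !(grmulDl, grmulDr) h1 h2.
elim/group_ring_ind: z => [|z1 z2 h1 h2|e k]; rewrite ?grmul0r //.
  by rewrite !grmulDr h1 h2.
by rewrite !grmulUU mulrA mulgA.
Qed.

Lemma grmul1l : left_id grone grmul.
Proof.
elim/group_ring_ind=> [|x y hx hy|c g]; first exact: grmul0r.
  by rewrite grmulDr hx hy.
by rewrite grmulUU mul1r mul1g.
Qed.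

Lemma grmul1r : right_id grone grmul.
Proof.
elim/group_ring_ind=> [|x y hx hy|c g]; first exact: grmul0l.
  by rewrite grmulDl hx hy.
by rewrite grmulUU mulr1 mulg1.
Qed.

Lemma grone_neq0 : grone != 0.
Proof. by rewrite monalgU_eq0. Qed.

HB.instance Definition _ := GRing.Zmodule_isNzRing.Build group_ring
  grmulA grmul1l grmul1r grmulDl grmulDr grone_neq0.

Definition gelt (g : G) : group_ring := << 1 *g g >>.

Lemma geltM g h : gelt (g * h)%g = gelt g * gelt h.
Proof. by rewrite [RHS]grmulUU mulr1. Qed.

Lemma gelt1 : gelt 1%g = 1. Proof. by []. Qed.

Definition Nsum (g : G) (m : nat) : group_ring :=
  \sum_(i < m.+1) gelt (g ^+ i)%g.

Definition aug (x : group_ring) : int := \sum_(g <- msupp x) x@_g.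

Lemma augw (d : {fset G}) x : msupp x `<=` d -> aug x = \sum_(g <- d) x@_g.
Proof.
by move=> le_d; apply: big_fset_incl => // k _ /mcoeff_outdom ->.
Qed.

Lemma augU c g : aug << c *g g >> = c.
Proof. by rewrite (augw msuppU_le) big_seq_fset1 mcoeffUU. Qed.

Lemma augD x y : aug (x + y) = aug x + aug y.
Proof.
rewrite (augw (msuppD_le x y)) (augw (fsubsetUl _ (msupp y))).
rewrite (augw (fsubsetUr (msupp x) _)) -big_split /=.
by apply/eq_bigr=> g _; rewrite mcoeffD.
Qed.

Lemma aug0 : aug 0 = 0.
Proof. by rewrite /aug msupp0 big_seq_fset0. Qed.

Lemma augM x y : aug (x * y) = aug x * aug y.
Proof.
elim/group_ring_ind: x => [|x1 x2 h1 h2|c g].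
- by rewrite mul0r aug0 mul0r.
- by rewrite mulrDl !augD h1 h2 mulrDl.
elim/group_ring_ind: y => [|y1 y2 h1 h2|d h].
- by rewrite mulr0 aug0 mulr0.
- by rewrite mulrDr !augD h1 h2 mulrDr.
by rewrite [_ * _ in LHS]grmulUU !augU.
Qed.

Lemma aug1 : aug 1 = 1. Proof. exact: augU. Qed.

(* The trivial Z[G]-module Z: x acts as multiplication by aug x, so that
   every element of G acts as the identity. *)
Definition trivial_module := int.

HB.instance Definition _ := GRing.Zmodule.on trivial_module.

Definition triv_scale (x : group_ring) (n : trivial_module) : trivial_module :=
  aug x * n.

Lemma triv_scaleA x y n : triv_scale x (triv_scale y n) = triv_scale (x * y) n.
Proof. by rewrite /triv_scale augM mulrA. Qed.

Lemma triv_scale1 : left_id 1 triv_scale.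
Proof. by move=> n; rewrite /triv_scale aug1 mul1r. Qed.

Lemma triv_scaleDr : right_distributive triv_scale +%R.
Proof. by move=> x m n; apply: mulrDr. Qed.

Lemma triv_scaleDl n : {morph triv_scale^~ n : x y / x + y}.
Proof. by move=> x y; rewrite /triv_scale augD mulrDl. Qed.

HB.instance Definition _ := GRing.Zmodule_isLmodule.Build
  group_ring trivial_module triv_scaleA triv_scale1 triv_scaleDr triv_scaleDl.

(* The augmentation, on Z[G] seen as the free left module of rank 1. *)
Definition augmentation (v : 'rV[group_ring]_1) : trivial_module :=
  aug (v ord0 ord0).

Lemma augmentation_linear : linear augmentation.
Proof. by move=> x u v; rewrite /augmentation !mxE augD augM. Qed.

HB.instance Definition _ := GRing.isLinear.Build group_ring
  'rV[group_ring]_1 trivial_module *:%R augmentation augmentation_linear.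

End GroupRing.

(* The differential from degree n + 1 to degree n is v |-> v *m D n. *)
Record free_resolution (R : pzRingType) (M : lmodType R) (d : nat -> nat)
    (D : forall n, 'M[R]_(d n.+1, d n)) (eps : {linear 'rV[R]_(d 0%N) -> M}) :
    Prop := FreeResolution {
  resolution_surj : forall m : M, exists v, eps v = m;
  resolution_exact0 : forall v : 'rV[R]_(d 0%N),
    eps v = 0%R <-> exists w : 'rV[R]_(d 1%N), v = (w *m D 0%N)%R;
  resolution_exactS : forall n (v : 'rV[R]_(d n.+1)),
    (v *m D n = 0)%R <-> exists w : 'rV[R]_(d n.+2), v = (w *m D n.+1)%R
}.

Definition mx_of_rows (R : pzRingType) (m n : nat) (s : seq (seq R)) :
    'M[R]_(m, n) :=
  (\matrix_(i < m, j < n) nth 0 (nth [::] s i) j)%R.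

(* The two generators are indexed by bool: false for a and S, true for b and
   U. The relation l = r is encoded by the relator l * r^-1. *)

Section TorusGroup.
Variables p q : nat.

Inductive torus_relator : free_group bool -> Prop :=
| torus_rel : torus_relator (fgen false ^+ p * (fgen true ^+ q)^-1).

Definition torus_group : groupType := presented torus_relator.

Definition torus_a : torus_group := pgen torus_relator false.
Definition torus_b : torus_group := pgen torus_relator true.

Lemma torus_eq : torus_a ^+ p = torus_b ^+ q.
Proof.
have := pres_rel torus_rel; rewrite gmulfM gmulfV !gmulfXn => /eqP.
by rewrite divg_eq1 => /eqP.
Qed.

Lemma torus_central k : central (torus_a ^+ (k * p)).
Proof.
apply: pres_central => x; rewrite mulnC expgnA.
apply: commute_sym; apply: commuteX.
by case: x; [rewrite torus_eq|]; apply: commuteX.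
Qed.

End TorusGroup.

Section Gamma.
Variables p q k : nat.

Definition Gamma : groupType := quotient_group (central_cycle (@torus_central p q k)).

Definition Gamma_S : Gamma := gproj (torus_a p q).
Definition Gamma_U : Gamma := gproj (torus_b p q).

Inductive SU_relator : free_group bool -> Prop :=
| SU_relS : SU_relator (fgen false ^+ (k * p))
| SU_relU : SU_relator (fgen true ^+ (k * q))
| SU_relSU : SU_relator (fgen false ^+ p * (fgen true ^+ q)^-1).

Definition SU_group : groupType := presented SU_relator.

Definition SU_S : SU_group := pgen SU_relator false.
Definition SU_U : SU_group := pgen SU_relator true.

Definition cyc_amalgam : groupType := amalgam (@cyc_embed k p) (@cyc_embed k q).

Definition cyc_amalgam_S : cyc_amalgam :=
  amalgam_inl (@cyc_embed k p) (@cyc_embed k q) (cyc_gen (k * p)).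
Definition cyc_amalgam_U : cyc_amalgam :=
  amalgam_inr (@cyc_embed k p) (@cyc_embed k q) (cyc_gen (k * q)).

Local Open Scope ring_scope.

Local Notation ZG := (group_ring Gamma).
Local Notation S := Gamma_S.
Local Notation U := Gamma_U.

Definition d1 : 'M[ZG]_(2, 1) :=
  mx_of_rows 2 1
    [:: [:: gelt S - 1];
        [:: gelt U - 1]].

Definition d2 : 'M[ZG]_(2, 2) :=
  mx_of_rows 2 2
    [:: [:: Nsum S (k * p).-1; 0];
        [:: Nsum S p.-1; - Nsum U q.-1]].

Definition d3 : 'M[ZG]_(2, 2) :=
  mx_of_rows 2 2
    [:: [:: gelt S - 1; 0];
        [:: gelt U - 1; (1 - gelt U) * Nsum (U ^+ q)%g k.-1]].

Definition res_rank (n : nat) : nat := if n is 0%N then 1%N else 2%N.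

(* res_diff n starts in degree n + 1: d1, d2, d3 are the differentials out of
   degree 1, the even degrees >= 2 and the odd degrees >= 3 respectively. *)
Definition res_diff (n : nat) : 'M[ZG]_(res_rank n.+1, res_rank n) :=
  match n with
  | 0%N => d1
  | m.+1 => if odd m then d3 else d2
  end.

End Gamma.

(* Main.v *)
Require Import Defs.
From HB Require Import structures.
From mathcomp Require Import all_boot all_order all_algebra.
From mathcomp Require Import finmap monalg boolp generic_quotient.

Set Implicit Arguments.
Unset Strict Implicit.
Unset Printing Implicit Defensive.

Import GRing.Theory.

Local Open Scope group_scope.

(* The group isomorphisms come from universal properties, and the orders of a,
   S and U are read off homomorphisms to finite cyclic groups.

   Exactness rests on two facts about R = Z[Gamma]. First, if g has finite order
   n and N is the sum of its powers, then in R the left annihilators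
   of g - 1 and N are R N and R (g - 1), as R is free over Z[<g>]. Second,
   R(S - 1) /\ R(U - 1) = R(S^p - 1), which is the exactness of the chain complex
   of the Bass-Serre tree. Instead of normal forms in the amalgam it is proved
   with a crossed homomorphism D such that D(S) = (S - 1) N_T, where T = S^p, and
   D(U) = 0: its left linear extension maps x (S - 1) = y (U - 1) to
   x (S - 1) N_T = 0, so x (S - 1) is in R(T - 1) by the first fact. *)

(* Unlike {multiplicative _ -> _}, this interface records that 1 is preserved. *)
Notation group_hom := UMagmaMorphism.type.

(** * Universal properties of free groups, quotients and presentations *)

Section FreeLift.
Local Open Scope quotient_scope.
Variables (X : choiceType) (H : groupType) (f : X -> H).

Definition letter_val (l : letter X) : H := if l.2 then (f l.1)^-1 else f l.1.

Definition word_val (w : seq (letter X)) : H := \prod_(l <- w) letter_val l.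

Lemma word_val_eqv u v : word_eqv u v -> word_val u = word_val v.
Proof.
elim=> // [v1 v2 v3 _ -> _ -> //|u' v' l].
rewrite /word_val !big_cat !big_cons; case: l => x [] /=.
  by rewrite /letter_val /= mulKg.
by rewrite /letter_val /= mulVKg.
Qed.

Definition free_lift (x : free_group X) : H := word_val (repr x).

Lemma free_lift_pi w : free_lift (\pi_(free_group X) w) = word_val w.
Proof. exact/word_val_eqv/repr_eqv. Qed.

Lemma free_liftM : {morph free_lift : x y / x * y}.
Proof.
elim/freeW=> u; elim/freeW=> v.
by rewrite [_ * _ in LHS]fmulE !free_lift_pi /word_val big_cat.
Qed.

HB.instance Definition _ :=
  monoid.isMultiplicative.Build (free_group X) H free_lift free_liftM.

Lemma free_lift1 : free_lift 1 = 1.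
Proof. by rewrite free_lift_pi /word_val big_nil. Qed.

HB.instance Definition _ :=
  Multiplicative_isUMagmaMorphism.Build (free_group X) H free_lift free_lift1.

Lemma free_lift_gen x : free_lift (fgen x) = f x.
Proof. by rewrite free_lift_pi /word_val big_seq1. Qed.

End FreeLift.

(** The lift evaluates [phi] on the chosen representative of a coset; this differs from any other
    representative by an element of [N], which [phi] kills. *)
Lemma quotient_lift (G H : groupType) (N : normal_subgroup G)
    (phi : group_hom G H) :
  (forall x, x \in normal_pred N -> phi x = 1) ->
  exists psi : group_hom (quotient_group N) H,
    forall x, psi (gproj x) = phi x.
Proof.
move=> phiN; pose psi (x : quotient_group N) := phi (repr x).
have psiE x : psi (gproj x) = phi x.
  have := phiN _ (inN_repr N x).
  by rewrite gmulfF => /eqP; rewrite divg_eq1 => /eqP.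
have psiM : {morph psi : x y / x * y}.
  move=> x y; have [u ->] := gproj_surj x; have [v ->] := gproj_surj y.
  by rewrite -gmulfM !psiE gmulfM.
have psi1 : psi 1 = 1 by rewrite -(gproj1 N) psiE gmulf1.
pose psi' : group_hom (quotient_group N) H :=
  HB.pack psi (monoid.isMultiplicative.Build _ _ psi psiM)
    (Multiplicative_isUMagmaMorphism.Build _ _ psi psi1).
by exists psi'.
Qed.

Lemma ker_group (G H : groupType) (phi : group_hom G H) :
  group_closed [pred x | phi x == 1].
Proof.
split=> [|x y]; rewrite !inE ?gmulf1 // => /eqP hx /eqP hy.
by rewrite gmulfF hx hy divg1.
Qed.

Lemma ker_conj (G H : groupType) (phi : group_hom G H) x y :
  x \in [pred x | phi x == 1] -> x ^ y \in [pred x | phi x == 1].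
Proof. by rewrite !inE => /eqP hx; rewrite gmulfJ hx conj1g. Qed.

Lemma presented_lift (X : choiceType) (R : free_group X -> Prop) (H : groupType)
    (f : X -> H) :
  (forall r, R r -> free_lift f r = 1) ->
  exists psi : group_hom (presented R) H,
    forall x, psi (pgen R x) = f x.
Proof.
move=> fR.
(* The normal closure is an intersection of normal subgroups, so it suffices that the kernel of
   [free_lift f] is one that contains the relators. *)
pose K := NormalSubgroup (@ker_group _ _ (free_lift f))
  (@ker_conj _ _ (free_lift f)).
have [x /asboolP /(_ K) xK|psi psiE] :=
  @quotient_lift _ _ (normal_closure R) (free_lift f).
  by apply/eqP/xK => r /fR fr; change (free_lift f r == 1); rewrite fr.
by exists psi => x; rewrite psiE; exact: free_lift_gen.
Qed.

Lemma presented_hom_eq (X : choiceType) (R : free_group X -> Prop)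
    (H : groupType) (phi psi : group_hom (presented R) H) :
  (forall x, phi (pgen R x) = psi (pgen R x)) -> phi =1 psi.
Proof.
move=> e; elim/pres_ind=> [|x y ih|x y ih]; first by rewrite !gmulf1.
  by rewrite !gmulfM ih e.
by rewrite !gmulfM ih !gmulfV e.
Qed.

(** * Homomorphisms out of the torus group, $\Gamma_k$ and its presentation on $S, U$ *)

Section Lifts.
Variables (p q k : nat) (H : groupType) (s u : H).
Hypothesis su : s ^+ p = u ^+ q.

Lemma torus_lift :
  exists psi : group_hom (torus_group p q) H,
    psi (torus_a p q) = s /\ psi (torus_b p q) = u.
Proof.
have [_ [] /=|psi psiE] :=
  @presented_lift _ (torus_relator p q) _ (fun b => if b then u else s).
  by rewrite gmulfF !gmulfXn /= !free_lift_gen su mulgV.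
by exists psi; split; apply: psiE.
Qed.

(** The subgroup generated by $a^{kp}$ is an intersection of subgroups, hence lies in the kernel of
    the torus lift once that kernel contains $a^{kp}$. *)
Lemma Gamma_lift : s ^+ (k * p) = 1 ->
  exists psi : group_hom (Gamma p q k) H,
    psi (Gamma_S p q k) = s /\ psi (Gamma_U p q k) = u.
Proof.
move=> sk; have [phi [phia phib]] := torus_lift.
have [x /asboolP xK|psi psiE] :=
  @quotient_lift _ _ (central_cycle (@torus_central p q k)) phi.
  apply/eqP/(xK [pred x | phi x == 1]) => [|_ ->]; first exact: ker_group.
  by rewrite inE gmulfXn phia sk.
by exists psi; split; rewrite psiE.
Qed.

Lemma SU_lift : s ^+ (k * p) = 1 ->
  exists psi : group_hom (SU_group p q k) H,
    psi (SU_S p q k) = s /\ psi (SU_U p q k) = u.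
Proof.
move=> sk.
have [_ [] /=|psi psiE] :=
  @presented_lift _ (SU_relator p q k) _ (fun b => if b then u else s).
- by rewrite gmulfXn /= free_lift_gen.
- by rewrite gmulfXn /= free_lift_gen mulnC expgnA -su -expgnA mulnC.
- by rewrite gmulfF !gmulfXn /= !free_lift_gen su mulgV.
by exists psi; split; apply: psiE.
Qed.

End Lifts.

Lemma torus_ind p q (P : torus_group p q -> Prop) :
  P 1 -> (forall x y, x = torus_a p q \/ x = torus_b p q -> P y -> P (x * y)) ->
  (forall x y, x = torus_a p q \/ x = torus_b p q -> P y -> P (x^-1 * y)) ->
  forall y, P y.
Proof.
move=> h1 hM hV; apply: pres_ind => // -[] y Py.
- by apply: hM => //; right.
- by apply: hM => //; left.
- by apply: hV => //; right.
- by apply: hV => //; left.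
Qed.

(** This shape, with both generators in one disjunction, is the hypothesis [G_ind] under which the
    augmentation ideal is computed in [aug_span]. *)
Lemma Gamma_ind p q k (P : Gamma p q k -> Prop) :
  P 1 ->
  (forall x y, x = Gamma_S p q k \/ x = Gamma_U p q k -> P y -> P (x * y)) ->
  (forall x y, x = Gamma_S p q k \/ x = Gamma_U p q k -> P y ->
    P (x^-1 * y)) ->
  forall y, P y.
Proof.
move=> h1 hM hV y; have [x ->] := gproj_surj y.
elim/torus_ind: x => [//|x z [] -> ih|x z [] -> ih].
- by rewrite gmulfM; apply: hM => //; left.
- by rewrite gmulfM; apply: hM => //; right.
- by rewrite gmulfM gmulfV; apply: hV => //; left.
- by rewrite gmulfM gmulfV; apply: hV => //; right.
Qed.

Lemma Gamma_hom_eq p q k (H : groupType)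
    (phi psi : group_hom (Gamma p q k) H) :
  phi (Gamma_S p q k) = psi (Gamma_S p q k) ->
  phi (Gamma_U p q k) = psi (Gamma_U p q k) -> phi =1 psi.
Proof.
move=> eS eU; elim/Gamma_ind=> [|x y hx ih|x y hx ih]; first by rewrite !gmulf1.
  by rewrite !gmulfM ih; case: hx => ->; rewrite ?eS ?eU.
by rewrite !gmulfM !gmulfV ih; case: hx => ->; rewrite ?eS ?eU.
Qed.

Lemma SU_hom_eq p q k (H : groupType)
    (phi psi : group_hom (SU_group p q k) H) :
  phi (SU_S p q k) = psi (SU_S p q k) ->
  phi (SU_U p q k) = psi (SU_U p q k) -> phi =1 psi.
Proof. by move=> eS eU; apply: presented_hom_eq => -[]. Qed.

(** * Defining relations, and the isomorphism of $\Gamma_k$ with its presentation *)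

Lemma Gamma_SU p q k : Gamma_S p q k ^+ p = Gamma_U p q k ^+ q.
Proof. by rewrite /Gamma_S -gmulfXn torus_eq gmulfXn. Qed.

Lemma Gamma_S_order p q k : Gamma_S p q k ^+ (k * p) = 1.
Proof.
rewrite /Gamma_S -gmulfXn -(gproj1 (central_cycle (@torus_central p q k))).
by apply/gproj_eq; rewrite divg1; apply: mem_gen.
Qed.

Lemma Gamma_U_order p q k : Gamma_U p q k ^+ (k * q) = 1.
Proof. by rewrite mulnC expgnA -Gamma_SU -expgnA mulnC Gamma_S_order. Qed.

Lemma SU_SU p q k : SU_S p q k ^+ p = SU_U p q k ^+ q.
Proof.
have := pres_rel (SU_relSU p q k); rewrite gmulfF !gmulfXn => /eqP.
by rewrite divg_eq1 => /eqP.
Qed.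

Lemma SU_S_order p q k : SU_S p q k ^+ (k * p) = 1.
Proof. by have := pres_rel (SU_relS p q k); rewrite gmulfXn. Qed.

Lemma SU_U_order p q k : SU_U p q k ^+ (k * q) = 1.
Proof. by have := pres_rel (SU_relU p q k); rewrite gmulfXn. Qed.

(** Each group satisfies the relations of the other; the two lifts are mutually inverse because both
    composites fix the generators. *)
Lemma Gamma_SU_iso p q k :
  exists f : {multiplicative Gamma p q k -> SU_group p q k},
    [/\ bijective f, f (Gamma_S p q k) = SU_S p q k
      & f (Gamma_U p q k) = SU_U p q k].
Proof.
have [f [fS fU]] := Gamma_lift (SU_SU p q k) (SU_S_order p q k).
have [g [gS gU]] := SU_lift (Gamma_SU p q k) (Gamma_S_order p q k).
exists f; split=> //; exists g.
  by apply: (@Gamma_hom_eq _ _ _ _ (g \o f) idfun) => /=; rewrite ?fS ?fU.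
by apply: (@SU_hom_eq _ _ _ _ (f \o g) idfun) => /=; rewrite ?gS ?gU.
Qed.

(** * Finite cyclic groups, and the infinite order of $a$ *)

Lemma cyc_expE n m : (cyc_gen n ^+ m : cyc n) = inZp m.
Proof.
elim: m => [|m ih]; first by apply: val_inj; rewrite /= mod0n.
by rewrite expgS ih; apply: val_inj; rewrite /= modnDm.
Qed.

Lemma cyc_gen_exp_eq1 n m : (0 < n)%N -> (cyc_gen n ^+ m == 1) = (n %| m).
Proof. by case: n => // n _; rewrite cyc_expE -val_eqE. Qed.

Lemma cyc_genE n (x : cyc n) : cyc_gen n ^+ x = x.
Proof. by rewrite cyc_expE valZpK. Qed.

Lemma torus_a_exp_neq1 p q m : (0 < p)%N -> (0 < q)%N -> (0 < m)%N ->
  torus_a p q ^+ m <> 1.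
Proof.
(* Sending $a$ to $q$ and $b$ to $p$ respects $a^p=b^q$ in every cyclic group; modulo $mq+1$ the
   image $mq$ of $a^m$ is nonzero. *)
move=> p0 q0 m0 am1; pose n := (m * q).+1.
have gpq : (cyc_gen n ^+ q) ^+ p = (cyc_gen n ^+ p) ^+ q.
  by rewrite -!expgnA mulnC.
have [phi [phia _]] := torus_lift gpq.
have := congr1 phi am1; rewrite gmulfXn phia gmulf1 -expgnA => /eqP.
by rewrite cyc_gen_exp_eq1 // gtnNdvd // ?muln_gt0 ?q0 // mulnC.
Qed.

Lemma expg_modn (G : groupType) (x : G) n m :
  x ^+ n = 1 -> x ^+ (m %% n) = x ^+ m.
Proof.
move=> xn; rewrite [in RHS](divn_eq m n) expgnDr mulnC expgnA xn.
by rewrite expg1n mul1g.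
Qed.

(** * Isomorphism with the amalgam of two cyclic groups *)

Section AmalgamIso.
Variables p q k : nat.
Hypotheses (p0 : (0 < p)%N) (q0 : (0 < q)%N) (k0 : (0 < k)%N).
Let f : cyc k -> cyc (k * p) := @cyc_embed k p.
Let g : cyc k -> cyc (k * q) := @cyc_embed k q.

Lemma amalgam_inlM : {morph amalgam_inl f g : x y / x * y}.
Proof.
move=> x y; have := pres_rel (amalgam_mulA f g x y); rewrite gmulfF gmulfM.
by move=> /eqP; rewrite divg_eq1 => /eqP.
Qed.

Lemma amalgam_inrM : {morph amalgam_inr f g : x y / x * y}.
Proof.
move=> x y; have := pres_rel (amalgam_mulB f g x y); rewrite gmulfF gmulfM.
by move=> /eqP; rewrite divg_eq1 => /eqP.
Qed.

HB.instance Definition _ := monoid.isMultiplicative.Build _ _ _ amalgam_inlM.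
HB.instance Definition _ := monoid.isMultiplicative.Build _ _ _ amalgam_inrM.

Lemma amalgam_inl1 : amalgam_inl f g 1 = 1.
Proof. by apply: (mulgI (amalgam_inl f g 1)); rewrite -gmulfM !mulg1. Qed.

Lemma amalgam_inr1 : amalgam_inr f g 1 = 1.
Proof. by apply: (mulgI (amalgam_inr f g 1)); rewrite -gmulfM !mulg1. Qed.

HB.instance Definition _ :=
  Multiplicative_isUMagmaMorphism.Build _ _ _ amalgam_inl1.
HB.instance Definition _ :=
  Multiplicative_isUMagmaMorphism.Build _ _ _ amalgam_inr1.

Lemma amalgam_inl_inr c : amalgam_inl f g (f c) = amalgam_inr f g (g c).
Proof.
have := pres_rel (amalgam_glue f g c); rewrite gmulfF.
by move=> /eqP; rewrite divg_eq1 => /eqP.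
Qed.

Lemma SU_amalgam_iso :
  exists g : {multiplicative SU_group p q k -> cyc_amalgam p q k},
    [/\ bijective g, g (SU_S p q k) = cyc_amalgam_S p q k
      & g (SU_U p q k) = cyc_amalgam_U p q k].
Proof.
have cyc_predK n : (0 < n)%N -> n.-1.+1 = n by move/prednK.
have kp0 : (0 < k * p)%N by rewrite muln_gt0 k0.
have kq0 : (0 < k * q)%N by rewrite muln_gt0 k0.
have embE m : (0 < m)%N -> cyc_gen (k * m) ^+ m = @cyc_embed k m (cyc_gen k).
  move=> m0; rewrite cyc_expE; apply: val_inj => /=.
  rewrite !cyc_predK ?muln_gt0 ?k0 //.
  by rewrite muln_modr muln1 [(m * k)%N]mulnC modn_mod.
have e : cyc_amalgam_S p q k ^+ p = cyc_amalgam_U p q k ^+ q.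
  rewrite /cyc_amalgam_S /cyc_amalgam_U -gmulfXn embE //.
  by rewrite [LHS]amalgam_inl_inr /g -embE // gmulfXn.
have eS : cyc_amalgam_S p q k ^+ (k * p) = 1.
  have -> : cyc_amalgam_S p q k ^+ (k * p) = amalgam_inl f g 1; last first.
    exact: gmulf1.
  rewrite /cyc_amalgam_S -gmulfXn; congr amalgam_inl.
  by apply/eqP; rewrite cyc_gen_exp_eq1.
have [phi [phiS phiU]] := SU_lift e eS.
(* The inverse map is prescribed on all elements of both cyclic groups, as these are the generators
   of the amalgam. Multiplication in [cyc n] reduces exponents modulo [n.-1.+1], which [modS] and
   [modU] absorb. *)
pose h (x : cyc (k * p) + cyc (k * q)) :=
  match x with inl x => SU_S p q k ^+ x | inr x => SU_U p q k ^+ x end.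
have modS m : SU_S p q k ^+ (m %% (k * p).-1.+1) = SU_S p q k ^+ m.
  by rewrite cyc_predK // expg_modn // SU_S_order.
have modU m : SU_U p q k ^+ (m %% (k * q).-1.+1) = SU_U p q k ^+ m.
  by rewrite cyc_predK // expg_modn // SU_U_order.
have [_ [a1 a2|b1 b2|c] /=|psi psiE] :=
  @presented_lift _ (amalgam_relator f g) _ h.
- by rewrite gmulfF gmulfM /= !free_lift_gen /= -expgnDr modS mulgV.
- by rewrite gmulfF gmulfM /= !free_lift_gen /= -expgnDr modU mulgV.
- by rewrite gmulfF /= !free_lift_gen /= modS modU !expgnA SU_SU mulgV.
exists phi; split=> //; exists psi.
  apply: (@SU_hom_eq _ _ _ _ (psi \o phi) idfun) => /=; rewrite ?phiS ?phiU psiE.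
    by rewrite /h /= modS.
  by rewrite /h /= modU.
(* Every generator of the amalgam is the image of a power of [cyc_gen], so this composite is also
   determined by $S$ and $U$. *)
apply: (@presented_hom_eq _ _ _ (phi \o psi) idfun) => x /=; rewrite psiE.
by case: x => x; rewrite /= gmulfXn ?phiS ?phiU -gmulfXn cyc_genE.
Qed.

End AmalgamIso.

(** * Geometric sums in a noncommutative ring *)

Section Geom.
Local Open Scope ring_scope.
Variable R : nzRingType.
Implicit Type x : R.

(** Indexed by the number of terms, so $\mathbf N_x^{n-1}$ is [geom x n] and the product formulas
    below carry no predecessors. *)
Definition geom x n := \sum_(i < n) x ^+ i.

Lemma geom_mulBl x n : (x - 1) * geom x n = x ^+ n - 1.
Proof. by rewrite subrX1. Qed.

Lemma geom_mulB x n : geom x n * (x - 1) = x ^+ n - 1.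
Proof.
rewrite -geom_mulBl mulr_sumr mulr_suml; apply: eq_bigr => j _.
by rewrite mulrBr mulrBl mulr1 mul1r -exprS -exprSr.
Qed.

(** Exponents below $mn$ are split by division with remainder by $n$. *)
Lemma geom_mul x m n : geom x (m * n) = geom (x ^+ n) m * geom x n.
Proof.
elim: m => [|m ih]; first by rewrite mul0n /geom !big_ord0 mul0r.
rewrite mulSn addnC /geom big_split_ord /= -/(geom _ _) ih.
rewrite big_ord_recr mulrDl; congr (_ + _).
rewrite mulr_sumr; apply: eq_bigr => i _ /=.
by rewrite exprD mulnC exprM.
Qed.

End Geom.

(** * Left annihilators of $g-1$ and of the norm of $g$ in a group ring *)

Section GroupRingTheory.
Variable G : groupType.
Local Open Scope ring_scope.
Implicit Types (x y z : group_ring G) (g h : G).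

Lemma geltX g n : gelt (g ^+ n)%g = gelt g ^+ n.
Proof. by elim: n => [|n ih]; rewrite ?expr0 // expgS geltM ih exprS. Qed.

Lemma NsumE g n : (0 < n)%N -> Nsum g n.-1 = geom (gelt g) n.
Proof.
by move=> n0; rewrite /Nsum prednK //; apply: eq_bigr => i _; rewrite geltX.
Qed.

Lemma mcoeff_mulr x g h : (x * gelt g)@_h = x@_(h * g^-1)%g.
Proof.
elim/group_ring_ind: x => [|x y ihx ihy|c k]; first by rewrite mul0r !mcoeff0.
  by rewrite mulrDl !mcoeffD ihx ihy.
by rewrite [_ * _ in LHS]grmulUU mulr1 !mcoeffU -(can2_eq (mulgK g) (mulgVK g)).
Qed.

Section CyclicSubgroup.
Variables (g : G) (n : nat).
Hypotheses (n0 : (0 < n)%N) (gn : forall i, (g ^+ i == 1)%g = (n %| i)%N).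

Local Notation norm := (geom (gelt g) n).

Lemma expg_order : (g ^+ n)%g = 1%g.
Proof. by apply/eqP; rewrite gn. Qed.

(** [choose] depends only on the predicate, here membership in the left coset of [h] modulo $\langle
    g\rangle$, so the whole coset gets one representative. Nonnegative exponents suffice since [g]
    has finite order. *)
Definition coset_rep h : G :=
  choose (fun k => `[< exists i, k = h * g ^+ i >])%g h.

Lemma coset_repP h : exists i, coset_rep h = (h * g ^+ i)%g.
Proof.
apply/asboolP; apply: (@chooseP G (fun k => `[< exists i, k = h * g ^+ i >])%g).
by apply/asboolP; exists 0%N; rewrite mulg1.
Qed.

Lemma coset_repM h i : coset_rep (h * g ^+ i)%g = coset_rep h.
Proof.
rewrite /coset_rep.
rewrite (@eq_choose G _ (fun k => `[< exists i, k = h * g ^+ i >])%g).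
  by apply: choose_id; apply/asboolP; [exists i|exists 0%N; rewrite mulg1].
move=> k; apply/asbool_equiv_eq; split=> -[j ->].
  by exists (i + j)%N; rewrite expgnDr mulgA.
(* $g^{i(n-1)}$ is the inverse of $g^i$. *)
exists (i * n.-1 + j)%N; rewrite -mulgA -expgnDr addnA -mulnS prednK //.
by rewrite expgnDr mulnC expgnA expg_order expg1n mul1g.
Qed.

Lemma coset_rep_id h : coset_rep (coset_rep h) = coset_rep h.
Proof. by have [i ri] := coset_repP h; rewrite {1}ri coset_repM. Qed.

Lemma expg_ord_inj (i j : 'I_n) : (g ^+ i = g ^+ j)%g -> i = j.
Proof.
wlog ij : i j / (i <= j)%N => [wl e|e].
  by case/orP: (leq_total i j) => ij; [apply: wl|symmetry; apply: wl].
have : (g ^+ (j - i) == 1)%g by rewrite expgnFr // e mulgV.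
rewrite gn => d; apply/val_inj/eqP; rewrite /= eqn_leq ij /= -subn_eq0.
rewrite -[_ == 0%N]negbK -lt0n; apply/negP => lt; move: (dvdn_leq lt d).
by rewrite leqNgt (leq_ltn_trans (leq_subr _ _) (ltn_ord j)).
Qed.

(** The chosen representatives form a basis of the group ring as a right module over $\mathbb
    Z[\langle g\rangle]$; these are the integral combinations of that basis. *)
Definition rep_supported y := forall h, coset_rep h != h -> y@_h = 0.

(** The coefficient is the sum of those of [y] at $hg^{-i}$ for $0\le i<n$, and exactly one of these
    elements is the representative. *)
Lemma mcoeff_mul_norm y h : rep_supported y -> (y * norm)@_h = y@_(coset_rep h).
Proof.
move=> ysupp; rewrite /geom mulr_sumr raddf_sum /=.
under eq_bigr => i _ do rewrite -geltX mcoeff_mulr.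
have [i0 repE] : exists i0 : 'I_n, coset_rep h = (h * (g ^+ i0)^-1)%g.
  have [i ri] := coset_repP h.
  pose j := (i * n.-1 %% n)%N; have jn : (j < n)%N by rewrite ltn_mod.
  exists (Ordinal jn); rewrite ri /=; congr (_ * _)%g.
  apply/eqP; rewrite -mulg_eq1 (expg_modn _ expg_order).
  by rewrite -expgnDr -mulnS prednK // gn dvdn_mull.
rewrite (bigD1 i0) //= -repE big1 ?addr0 // => i i_neq; apply: ysupp.
have -> : coset_rep (h * (g ^+ i)^-1) = coset_rep h.
  by rewrite -(coset_repM _ i) mulgVK.
rewrite repE; apply: contra i_neq => /eqP /mulgI /invg_inj /expg_ord_inj ->.
exact: eqxx.
Qed.

(** The equation makes the coefficients of [x] constant on left cosets of $\langle g\rangle$; [z] is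
    the restriction of [x] to the representatives. *)
Lemma ker_subr1 x : x * (gelt g - 1) = 0 -> exists z, x = z * norm.
Proof.
move=> /eqP; rewrite mulrBr mulr1 subr_eq0 => /eqP xg.
have xM h i : x@_(h * g ^+ i)%g = x@_h.
  elim: i => [|i ih]; first by rewrite mulg1.
  by rewrite -{1}xg expgSr mulgA mcoeff_mulr mulgK.
pose z : group_ring G :=
  [malg h in msupp x => if coset_rep h == h then x@_h else 0].
have zE h : z@_h = if coset_rep h == h then x@_h else 0.
  rewrite [LHS]mcoeffE; case: ifP => // /negbT /mcoeff_outdom ->.
  by rewrite if_same.
exists z; apply/malgP => h; rewrite mcoeff_mul_norm; last first.
  by move=> k /negPf rk; rewrite zE rk.
have [i ri] := coset_repP h.
by rewrite zE coset_rep_id eqxx ri xM.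
Qed.

Lemma sub_coset_rep x : exists y z, rep_supported y /\ x = y + z * (gelt g - 1).
Proof.
elim/group_ring_ind: x => [|x1 x2 [y1 [z1 [s1 ->]]] [y2 [z2 [s2 ->]]]|c h].
- exists 0, 0; rewrite mul0r addr0; split=> // h _; exact: mcoeff0.
- exists (y1 + y2), (z1 + z2); rewrite mulrDl addrACA; split=> // h hh.
  by rewrite mcoeffD s1 ?s2 ?addr0.
have [i ri] := coset_repP h.
(* With $r=hg^i$ the representative, $h=r-h(g^i-1)$, and $g^i-1$ is a multiple of $g-1$. *)
exists << c *g coset_rep h >>,
  (- (<< c *g h >> : group_ring G) * geom (gelt g) i).
split.
  move=> k rk; rewrite mcoeffU; case: eqP => // e.
  by rewrite -e coset_rep_id eqxx in rk.
rewrite -mulrA geom_mulB mulNr mulrBr mulr1 -geltX [_ * gelt _]grmulUU.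
by rewrite mulr1 -ri opprB addrC subrK.
Qed.

(** Modulo multiples of $g-1$, which the norm kills, [x] is supported on representatives; there its
    coefficients are read off the product with the norm, so they vanish. *)
Lemma ker_norm x : x * norm = 0 -> exists z, x = z * (gelt g - 1).
Proof.
move=> xN; have [y [z [sy xE]]] := sub_coset_rep x; exists z.
suff y0 : y = 0 by rewrite xE y0 add0r.
have yN : y * norm = 0.
  move: xN; rewrite xE mulrDl -mulrA geom_mulBl.
  rewrite -geltX expg_order.
  by rewrite gelt1 subrr mulr0 addr0.
apply/malgP => h; rewrite mcoeff0.
have [rh|rh] := eqVneq (coset_rep h) h; last exact: sy.
by rewrite -rh -mcoeff_mul_norm // yN mcoeff0.
Qed.

End CyclicSubgroup.

Lemma monalgU_int (c : int) h : (<< c *g h >> : group_ring G) = c%:~R * gelt h.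
Proof.
rewrite mulrzl /gelt.
have -> : (<< c *g h >> : group_ring G) = << (1 *~ c) *g h >> by rewrite intz.
by rewrite raddfMz.
Qed.

Definition lin_ext (D : G -> group_ring G) x : group_ring G :=
  mmap (intr : int -> group_ring G) D x.

(** On a group element $h$ the crossed rule gives $D(hg)-D(h)=hD(g)$; the rest is linearity. *)
Lemma lin_ext_crossed (D : G -> group_ring G) g x :
  (forall h, D (h * g)%g = D h + gelt h * D g) ->
  lin_ext D (x * (gelt g - 1)) = x * D g.
Proof.
move=> DM; rewrite /lin_ext.
elim/group_ring_ind: x => [|x y ihx ihy|c h].
- by rewrite !mul0r mmap0.
- by rewrite !mulrDl mmapD ihx ihy.
rewrite mulrBr mulr1 mmapB [_ * gelt _]grmulUU mulr1 !mmapU DM mulrDr.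
by rewrite addrC addKr monalgU_int mulrA.
Qed.

End GroupRingTheory.

(** * The semidirect product $\mathbb Z[G]\rtimes G$ *)

Section Semidirect.
Variable G : groupType.

(** A homomorphism $g\mapsto(D(g),g)$ into this group is the same as a crossed homomorphism $D$, so
    crossed homomorphisms can be built from universal properties. *)
Definition semidirect := (group_ring G * G)%type.
HB.instance Definition _ := Choice.on semidirect.

Definition sdmul (x y : semidirect) : semidirect :=
  ((x.1 + gelt x.2 * y.1)%R, x.2 * y.2).
Definition sdone : semidirect := (0%R, 1).
Definition sdinv (x : semidirect) : semidirect :=
  ((- (gelt x.2^-1%g * x.1))%R, x.2^-1).

Lemma sdmulA : associative sdmul.
Proof.
move=> x y z; congr pair; last exact: mulgA.
by rewrite /= geltM mulrDr !mulrA addrA.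
Qed.

Lemma sdmul1 : left_id sdone sdmul.
Proof. by case=> x g; rewrite /sdmul /= gelt1 mul1r add0r mul1g. Qed.

Lemma sdmul1r : right_id sdone sdmul.
Proof. by case=> x g; rewrite /sdmul /= mulr0 addr0 mulg1. Qed.

Lemma sdmulV : left_inverse sdone sdinv sdmul.
Proof. by case=> x g; rewrite /sdmul /= addNr mulVg. Qed.

Lemma sdmulVr : right_inverse sdone sdinv sdmul.
Proof.
case=> x g; rewrite /sdmul /= mulrN mulrA -geltM mulgV gelt1 mul1r.
by rewrite subrr.
Qed.

HB.instance Definition _ :=
  isGroup.Build semidirect sdmulA sdmul1 sdmul1r sdmulV sdmulVr.

Definition sdproj (x : semidirect) : G := x.2.

HB.instance Definition _ :=
  monoid.isMultiplicative.Build semidirect G sdproj (fun _ _ => erefl).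
HB.instance Definition _ :=
  Multiplicative_isUMagmaMorphism.Build semidirect G sdproj erefl.

(** Reduces the defining relations of $\Gamma_k$, for lifted generators, to equations between norm
    multiples. *)
Lemma sdexpE (x : group_ring G) g n :
  ((x, g) : semidirect) ^+ n = ((geom (gelt g) n * x)%R, g ^+ n).
Proof.
elim: n => [|n ih]; first by rewrite /geom big_ord0 mul0r.
rewrite expgSr ih; congr pair; last by rewrite expgSr.
by rewrite /= /geom big_ord_recr mulrDl geltX.
Qed.

End Semidirect.

(** * Left ideals with two generators *)

Section Span.
Local Open Scope ring_scope.
Variables (R : nzRingType) (s u : R).
Implicit Types x y z : R.

Definition span2 x := exists a b, x = a * s + b * u.

Lemma span2_0 : span2 0.
Proof. by exists 0, 0; rewrite !mul0r addr0. Qed.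

Lemma span2_l : span2 s.
Proof. by exists 1, 0; rewrite mul1r mul0r addr0. Qed.

Lemma span2_r : span2 u.
Proof. by exists 0, 1; rewrite mul1r mul0r add0r. Qed.

Lemma span2D x y : span2 x -> span2 y -> span2 (x + y).
Proof.
move=> [a [b ->]] [c [d ->]]; exists (a + c), (b + d).
by rewrite !mulrDl addrACA.
Qed.

Lemma span2_mul z x : span2 x -> span2 (z * x).
Proof.
by move=> [a [b ->]]; exists (z * a), (z * b); rewrite mulrDr !mulrA.
Qed.

Lemma span2_mulB1 x y : span2 (x - 1) -> span2 (y - 1) -> span2 (x * y - 1).
Proof.
move=> sx sy; have -> : x * y - 1 = x * (y - 1) + (x - 1).
  by rewrite mulrBr mulr1 addrA subrK.
by apply: span2D => //; apply: span2_mul.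
Qed.

Lemma span2_invB1 x y : span2 (x - 1) -> y * x = 1 -> span2 (y - 1).
Proof.
move=> sx yx; have -> : y - 1 = - y * (x - 1).
  by rewrite mulNr mulrBr yx mulr1 opprB.
exact: span2_mul.
Qed.

End Span.

(** * Intersection of $R(S-1)$ with $R(U-1)$, and the augmentation ideal *)

Section AugmentationIdeals.
Variables (p q k : nat) (G : groupType) (S U : G).
Hypotheses (p0 : (0 < p)%N) (k0 : (0 < k)%N).
Local Open Scope ring_scope.

Hypothesis order_S : forall i, (S ^+ i == 1)%g = (k * p %| i)%N.
Hypothesis G_ind : forall P : G -> Prop, P 1%g ->
  (forall x y, x = S \/ x = U -> P y -> P (x * y)%g) ->
  (forall x y, x = S \/ x = U -> P y -> P (x^-1 * y)%g) -> forall y, P y.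
Hypothesis G_derivation : forall d : group_ring G, geom (gelt S) p * d = 0 ->
  exists D : G -> group_ring G,
    [/\ forall g h, D (g * h)%g = D g + gelt g * D h, D S = d & D U = 0].

Lemma order_T i : ((S ^+ p) ^+ i == 1)%g = (k %| i)%N.
Proof. by rewrite -expgnA order_S mulnC dvdn_pmul2l. Qed.

Lemma augmentation_ideals_meet (x y : group_ring G) :
  x * (gelt S - 1) = y * (gelt U - 1) ->
  exists z, x * (gelt S - 1) = z * (gelt S ^+ p - 1).
Proof.
move=> e; pose N := geom (gelt (S ^+ p)%g) k.
(* With $T=S^p$, the product telescopes to $(T-1)\mathbf N_T^{k-1}=T^k-1=0$, which is the condition
   for a derivation with $D(S)=(S-1)\mathbf N_T^{k-1}$ and $D(U)=0$. *)
have Nd : geom (gelt S) p * ((gelt S - 1) * N) = 0.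
  rewrite mulrA geom_mulB -geltX geom_mulBl -geltX -expgnA mulnC.
  by rewrite (eqP (_ : S ^+ (k * p) == 1)%g) ?order_S // gelt1 subrr.
have [D [DM DS DU]] := G_derivation Nd.
have eS := lin_ext_crossed x (DM^~ S).
have eU := lin_ext_crossed y (DM^~ U).
have := etrans (esym eS) (etrans (congr1 (lin_ext D) e) eU).
rewrite DS DU mulr0 mulrA => /(ker_norm k0 order_T) [z ->].
by exists z; rewrite geltX.
Qed.

(** By linearity only $g-1$ matters; it is handled by induction on a word for $g$ through
    $gh-1=g(h-1)+(g-1)$ and $g^{-1}-1=-g^{-1}(g-1)$. *)
Lemma aug_span (x : group_ring G) :
  span2 (gelt S - 1) (gelt U - 1) (x - (aug x)%:~R).
Proof.
elim/group_ring_ind: x => [|x y ihx ihy|c g].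
- rewrite aug0 subrr; exact: span2_0.
- rewrite augD intrD opprD addrACA; exact: span2D.
rewrite augU monalgU_int -{2}[c%:~R]mulr1 -mulrBr; apply: span2_mul.
have span_gen h : h = S \/ h = U -> span2 (gelt S - 1) (gelt U - 1) (gelt h - 1).
  by case=> ->; [exact: span2_l|exact: span2_r].
elim/G_ind: g => [|g h /span_gen gg ih|g h /span_gen gg ih].
- rewrite gelt1 subrr; exact: span2_0.
- rewrite geltM; exact: span2_mulB1.
- rewrite geltM; apply: span2_mulB1 => //.
  by apply: span2_invB1 gg _; rewrite -geltM mulVg.
Qed.

End AugmentationIdeals.

(** * Orders of $S$ and $U$, and derivations on $\Gamma_k$ *)

Section Gamma.
Variables p q k : nat.
Hypotheses (p0 : (0 < p)%N) (q0 : (0 < q)%N) (k0 : (0 < k)%N).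

Local Notation G := (Gamma p q k).
Local Notation S := (Gamma_S p q k).
Local Notation U := (Gamma_U p q k).

(** In $\mathbb Z/kpq$ the elements $q$ and $p$ have orders exactly $kp$ and $kq$, which bounds the
    orders of $S$ and $U$ from below. *)
Lemma Gamma_cyc : exists phi : group_hom G (cyc (k * p * q)),
  phi S = cyc_gen _ ^+ q /\ phi U = cyc_gen _ ^+ p.
Proof.
apply: Gamma_lift; first by rewrite -!expgnA [(q * p)%N]mulnC.
apply/eqP; rewrite -expgnA cyc_gen_exp_eq1 ?muln_gt0 ?k0 ?p0 //.
by rewrite [(q * _)%N]mulnC.
Qed.

Lemma Gamma_S_expg_eq1 i : (S ^+ i == 1) = (k * p %| i).
Proof.
apply/idP/idP => [/eqP e|/dvdnP[j ->]]; last first.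
  by rewrite mulnC expgnA Gamma_S_order expg1n.
have [phi [phiS _]] := Gamma_cyc.
have := congr1 phi e; rewrite gmulfXn phiS gmulf1 -expgnA => /eqP.
rewrite cyc_gen_exp_eq1 ?muln_gt0 ?k0 ?p0 //.
by rewrite [(q * i)%N]mulnC dvdn_pmul2r.
Qed.

Lemma Gamma_U_expg_eq1 i : (U ^+ i == 1) = (k * q %| i).
Proof.
apply/idP/idP => [/eqP e|/dvdnP[j ->]]; last first.
  by rewrite mulnC expgnA Gamma_U_order expg1n.
have [phi [_ phiU]] := Gamma_cyc.
have := congr1 phi e; rewrite gmulfXn phiU gmulf1 -expgnA => /eqP.
rewrite cyc_gen_exp_eq1 ?muln_gt0 ?k0 ?p0 //.
by rewrite mulnAC [(p * i)%N]mulnC dvdn_pmul2r.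
Qed.

Local Open Scope ring_scope.

(** The hypothesis gives $(d,S)^p=(0,S^p)=(0,U)^q$, so $S\mapsto(d,S)$, $U\mapsto(0,U)$ extends to
    $\Gamma_k$; the first component of the extension is [D]. *)
Lemma fox_derivation (d : group_ring G) :
  geom (gelt S) p * d = 0 ->
  exists D : G -> group_ring G,
    [/\ forall g h, D (g * h)%g = D g + gelt g * D h, D S = d & D U = 0].
Proof.
move=> Nd; pose s : semidirect G := (d, S); pose u : semidirect G := (0, U).
have su : (s ^+ p = u ^+ q)%g by rewrite !sdexpE Nd mulr0 Gamma_SU.
have sk : (s ^+ (k * p) = 1)%g.
  by rewrite mulnC expgnA sdexpE Nd sdexpE mulr0 -expgnA mulnC Gamma_S_order.
(* The second component of [psi] fixes both generators, so it is the identity; this turns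
   multiplicativity into the crossed rule. *)
have [psi [psiS psiU]] := Gamma_lift su sk.
have psi2 g : (psi g).2 = g.
  apply: (@Gamma_hom_eq _ _ _ _ (@sdproj G \o psi) idfun) => /=.
    by rewrite psiS.
  by rewrite psiU.
exists (fun g => (psi g).1); split; rewrite ?psiS ?psiU // => g h.
by rewrite gmulfM /= psi2.
Qed.

End Gamma.

(** * Matrix equations for rows of length two, in coordinates *)

Section RowPairs.
Local Open Scope ring_scope.
Variable R : nzRingType.

Definition row2 (a b : R) : 'rV[R]_2 := \row_j (if j == ord0 then a else b).

Lemma row2P (v : 'rV[R]_2) a b :
  v = row2 a b <-> v ord0 ord0 = a /\ v ord0 ord_max = b.
Proof.
split=> [->|[e0 e1]]; first by rewrite !mxE.
apply/rowP => i; rewrite mxE; case: eqP => [->|i0] //.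
rewrite -e1; congr (v _ _); apply: val_inj; case: i i0 => [[|[|//]] i] //= i0.
by case: i0; apply: val_inj.
Qed.

Lemma row2_eq0 (a b : R) : row2 a b = 0 <-> a = 0 /\ b = 0.
Proof.
split=> [/esym/row2P|[-> ->]]; first by rewrite !mxE => -[<- <-].
by apply/esym/row2P; rewrite !mxE.
Qed.

Lemma row2_mul n (v : 'rV[R]_2) (M : 'M[R]_(2, n)) j :
  (v *m M) ord0 j = v ord0 ord0 * M ord0 j + v ord0 ord_max * M ord_max j.
Proof.
rewrite !mxE big_ord_recl big_ord1; congr (_ + _ * _).
  by congr (v _ _); apply: val_inj.
by congr (M _ _); apply: val_inj.
Qed.

Lemma row2_mul21 (v : 'rV[R]_2) a b :
  v *m mx_of_rows 2 1 [:: [:: a]; [:: b]] =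
  \row__ (v ord0 ord0 * a + v ord0 ord_max * b).
Proof. by apply/rowP => j; rewrite ord1 row2_mul !mxE. Qed.

Lemma row2_mul22 (v : 'rV[R]_2) a b c d :
  v *m mx_of_rows 2 2 [:: [:: a; b]; [:: c; d]] =
  row2 (v ord0 ord0 * a + v ord0 ord_max * c)
    (v ord0 ord0 * b + v ord0 ord_max * d).
Proof. by apply/row2P; rewrite !row2_mul !mxE. Qed.

Lemma row2_image (v : 'rV[R]_2) a b c d :
  (exists w : 'rV[R]_2, v = w *m mx_of_rows 2 2 [:: [:: a; b]; [:: c; d]]) <->
  exists x y, v ord0 ord0 = x * a + y * c /\ v ord0 ord_max = x * b + y * d.
Proof.
split=> [[w ->]|[x [y e]]].
  by exists (w ord0 ord0), (w ord0 ord_max); rewrite row2_mul22 !mxE.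
by exists (row2 x y); rewrite row2_mul22 !mxE; apply/row2P.
Qed.

End RowPairs.

(** * Exactness of the periodic complex from annihilator conditions in a ring *)

Section Exactness.
Local Open Scope ring_scope.
Variables (R : nzRingType) (p q k : nat) (s u : R).
Hypotheses (su : s ^+ p = u ^+ q) (sk : s ^+ (k * p) = 1).
Hypothesis ker_s :
  forall x, x * (s - 1) = 0 -> exists z, x = z * geom s (k * p).
Hypothesis ker_Ns :
  forall x, x * geom s (k * p) = 0 -> exists z, x = z * (s - 1).
Hypothesis ker_u :
  forall x, x * (u - 1) = 0 -> exists z, x = z * geom u (k * q).
Hypothesis ker_Nu :
  forall x, x * geom u (k * q) = 0 -> exists z, x = z * (u - 1).
Hypothesis ker_t :
  forall x, x * (s ^+ p - 1) = 0 -> exists z, x = z * geom (s ^+ p) k.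
Hypothesis meet : forall x y, x * (s - 1) = y * (u - 1) ->
  exists z, x * (s - 1) = z * (s ^+ p - 1).

(** Writing the common value $x(s-1)=-y(u-1)$ as $z(s^p-1)$, both $x-z\mathbf N_s^{p-1}$ and
    $-y-z\mathbf N_u^{q-1}$ are annihilated, by $s-1$ and $u-1$, hence are multiples of full
    norms. *)
Lemma exact_pair1 x y : x * (s - 1) + y * (u - 1) = 0 <->
  exists a b, x = a * geom s (k * p) + b * geom s p /\ y = - (b * geom u q).
Proof.
split=> [e|[a [b [-> ->]]]]; last first.
  rewrite mulrDl mulNr -!mulrA !geom_mulB sk su subrr mulr0 add0r.
  by rewrite subrr.
have e' : x * (s - 1) = (- y) * (u - 1).
  by apply/eqP; rewrite mulNr -addr_eq0 e.
have [z ez] := meet e'.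
have [w ew] : exists w, x - z * geom s p = w * geom s (k * p).
  by apply: ker_s; rewrite mulrBl -mulrA geom_mulB ez subrr.
have [w' ew'] : exists w', - y - z * geom u q = w' * geom u (k * q).
  by apply: ker_u; rewrite mulrBl -mulrA geom_mulB -su -ez -e' subrr.
(* The multiple [w'] of the full norm of [u] is moved into the second coefficient; it then adds [w']
   times the full norm of [s] to the first coordinate, which $w-w'$ compensates. *)
exists (w - w'), (z + w' * geom (s ^+ p) k); split.
  rewrite [X in _ + X]mulrDl -mulrA -geom_mul mulrBl -ew.
  by rewrite [X in _ + X]addrC addrA subrK subrK.
by rewrite mulrDl -mulrA su -geom_mul -ew' addrC subrK opprK.
Qed.

Lemma norm_u_eq0 : (u - 1) * geom u (k * q) = 0.
Proof. by rewrite geom_mulBl mulnC exprM -su -exprM mulnC sk subrr. Qed.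

Lemma exact_pair2 x y :
  (x * geom s (k * p) + y * geom s p = 0 /\ y * geom u q = 0) <->
  exists a b, x = a * (s - 1) + b * (u - 1) /\
    y = b * ((1 - u) * geom (u ^+ q) k).
Proof.
split=> [[e1 e2]|[a [b [-> ->]]]]; last first.
  split; rewrite -[1 - u]opprB ?mulrDl -!mulrA ?mulNr -?mulrA -?su -?geom_mul.
    by rewrite geom_mulBl sk subrr mulr0 add0r -mulrDr subrr mulr0.
  by rewrite su -geom_mul norm_u_eq0 oppr0 mulr0.
(* Hence $y=z\mathbf N_t^{k-1}$ with $t=s^p=u^q$. The two equations then say that $x+z$ and $z$ are
   killed by the full norms of [s] and [u] respectively. *)
have yt : y * (s ^+ p - 1) = 0 by rewrite su -geom_mulB mulrA e2 mul0r.
have [z ez] := ker_t yt.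
have [v ev] : exists v, x + z = v * (s - 1).
  by apply: ker_Ns; rewrite mulrDl [in X in _ + X]geom_mul mulrA -ez.
have [w ew] : exists w, z = w * (u - 1).
  by apply: ker_Nu; rewrite geom_mul mulrA -su -ez.
exists v, (- w); split; first by rewrite -ev mulNr -ew addrK.
by rewrite ez ew su -[1 - u]opprB mulNr mulNr mulrN opprK mulrA.
Qed.

(** The second equation follows from the first: $y$ is then a left multiple of $\mathbf N_u^{q-1}$,
    and $\mathbf N_u^{q-1}(1-u)\mathbf N_t^{k-1}=1-t^k=0$ for $t=u^q$. So $\partial_3$ and
    $\partial_1$ have the same kernel. *)
Lemma exact_pair3 x y :
  (x * (s - 1) + y * (u - 1) = 0 /\ y * ((1 - u) * geom (u ^+ q) k) = 0) <->
  exists a b, x = a * geom s (k * p) + b * geom s p /\ y = - (b * geom u q).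
Proof.
rewrite -exact_pair1; split=> [[]//|e]; split=> //.
have [a [b [_ ->]]] := (exact_pair1 x y).1 e.
rewrite mulNr -mulrA [geom u q * _]mulrA -[1 - u]opprB mulrN geom_mulB mulNr.
by rewrite geom_mulBl -su -exprM mulnC sk subrr oppr0 mulr0 oppr0.
Qed.

Let D1 := mx_of_rows 2 1 [:: [:: s - 1]; [:: u - 1]].
Let D2 := mx_of_rows 2 2
  [:: [:: geom s (k * p); 0]; [:: geom s p; - geom u q]].
Let D3 := mx_of_rows 2 2
  [:: [:: s - 1; 0]; [:: u - 1; (1 - u) * geom (u ^+ q) k]].

Lemma image_D2 (v : 'rV[R]_2) : (exists w : 'rV[R]_2, v = w *m D2) <->
  exists a b, v ord0 ord0 = a * geom s (k * p) + b * geom s p /\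
    v ord0 ord_max = - (b * geom u q).
Proof.
rewrite row2_image; split=> -[a [b e]]; exists a, b; move: e;
  by rewrite mulr0 add0r mulrN.
Qed.

Lemma exact_mx1 (v : 'rV[R]_2) :
  v *m D1 = 0 <-> exists w : 'rV[R]_2, v = w *m D2.
Proof.
rewrite image_D2 -exact_pair1 row2_mul21.
split=> [/rowP/(_ ord0)|->]; first by rewrite !mxE.
by apply/rowP => i; rewrite !mxE.
Qed.

Lemma exact_mx2 (v : 'rV[R]_2) :
  v *m D2 = 0 <-> exists w : 'rV[R]_2, v = w *m D3.
Proof.
rewrite row2_mul22 row2_eq0 row2_image mulr0 add0r mulrN.
have opp_eq0 (z : R) : - z = 0 <-> z = 0.
  by split=> [/eqP|->]; rewrite ?oppr0 // oppr_eq0 => /eqP.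
rewrite opp_eq0 exact_pair2; split=> -[a [b e]]; exists a, b; move: e;
  by rewrite mulr0 add0r.
Qed.

Lemma exact_mx3 (v : 'rV[R]_2) :
  v *m D3 = 0 <-> exists w : 'rV[R]_2, v = w *m D2.
Proof.
by rewrite image_D2 -exact_pair3 row2_mul22 row2_eq0 mulr0 add0r.
Qed.

End Exactness.

(** * Assembly of the free resolution *)

Section Resolution.
Variables p q k : nat.
Hypotheses (p0 : (0 < p)%N) (q0 : (0 < q)%N) (k0 : (0 < k)%N).
Local Open Scope ring_scope.

Section Abstract.
Variables (G : groupType) (S U : G).

Lemma Nsum_d2 :
  mx_of_rows 2 2 [:: [:: Nsum S (k * p).-1; 0]; [:: Nsum S p.-1; - Nsum U q.-1]]
  = mx_of_rows 2 2 [:: [:: geom (gelt S) (k * p); 0];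
      [:: geom (gelt S) p; - geom (gelt U) q]].
Proof. by rewrite !NsumE // muln_gt0 k0. Qed.

Lemma Nsum_d3 :
  mx_of_rows 2 2 [:: [:: gelt S - 1; 0];
    [:: gelt U - 1; (1 - gelt U) * Nsum (U ^+ q)%g k.-1]]
  = mx_of_rows 2 2 [:: [:: gelt S - 1; 0];
      [:: gelt U - 1; (1 - gelt U) * geom (gelt U ^+ q) k]].
Proof. by rewrite !NsumE // geltX. Qed.

Hypothesis SU : (S ^+ p = U ^+ q)%g.
Hypothesis order_S : forall i, (S ^+ i == 1)%g = (k * p %| i)%N.
Hypothesis order_U : forall i, (U ^+ i == 1)%g = (k * q %| i)%N.
Hypothesis G_derivation : forall d : group_ring G, geom (gelt S) p * d = 0 ->
  exists D : G -> group_ring G,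
    [/\ forall g h, D (g * h)%g = D g + gelt g * D h, D S = d & D U = 0].

Let D1 := mx_of_rows 2 1 [:: [:: gelt S - 1]; [:: gelt U - 1]].
Let D2 := mx_of_rows 2 2 [:: [:: geom (gelt S) (k * p); 0];
      [:: geom (gelt S) p; - geom (gelt U) q]].
Let D3 := mx_of_rows 2 2 [:: [:: gelt S - 1; 0];
      [:: gelt U - 1; (1 - gelt U) * geom (gelt U ^+ q) k]].

(** The annihilator conditions come from the cyclic subgroups generated by $S$, $U$ and $S^p$, of
    orders $kp$, $kq$ and $k$. *)
Lemma exact_periodic (v : 'rV[group_ring G]_2) :
  [/\ v *m D1 = 0 <-> exists w : 'rV[group_ring G]_2, v = w *m D2,
      v *m D2 = 0 <-> exists w : 'rV[group_ring G]_2, v = w *m D3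
    & v *m D3 = 0 <-> exists w : 'rV[group_ring G]_2, v = w *m D2].
Proof.
have kp0 : (0 < k * p)%N by rewrite muln_gt0 k0.
have kq0 : (0 < k * q)%N by rewrite muln_gt0 k0.
have su : gelt S ^+ p = gelt U ^+ q by rewrite -!geltX SU.
have sk : gelt S ^+ (k * p) = 1.
  by rewrite -geltX (expg_order order_S) gelt1.
have ker_t x : x * (gelt S ^+ p - 1) = 0 ->
    exists z, x = z * geom (gelt S ^+ p) k.
  by rewrite -geltX; apply: (ker_subr1 k0 (order_T p0 order_S)).
have ker_s := @ker_subr1 _ _ _ kp0 order_S.
have ker_u := @ker_subr1 _ _ _ kq0 order_U.
have ker_Ns := @ker_norm _ _ _ kp0 order_S.
have ker_Nu := @ker_norm _ _ _ kq0 order_U.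
have meet := augmentation_ideals_meet p0 k0 order_S G_derivation.
split.
- exact: exact_mx1 su sk ker_s ker_u meet v.
- exact: exact_mx2 su sk ker_Ns ker_Nu ker_t v.
- exact: exact_mx3 su sk ker_s ker_u meet v.
Qed.

Hypothesis G_ind : forall P : G -> Prop, P 1%g ->
  (forall x y, x = S \/ x = U -> P y -> P (x * y)%g) ->
  (forall x y, x = S \/ x = U -> P y -> P (x^-1 * y)%g) -> forall y, P y.

Lemma aug_geltB1 (g : G) : aug (gelt g - 1) = 0.
Proof. by apply/(addIr 1); rewrite -{1}(aug1 G) -augD subrK augU add0r. Qed.

Lemma exact_aug (v : 'rV[group_ring G]_1) :
  augmentation v = 0 <-> exists w : 'rV[group_ring G]_2, v = w *m D1.
Proof.
rewrite /augmentation; split=> [e|[w ->]].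
  have [a [b]] := aug_span G_ind (v ord0 ord0).
  rewrite e subr0 => E; exists (row2 a b).
  by apply/rowP => i; rewrite ord1 row2_mul21 !mxE.
by rewrite row2_mul21 mxE augD !augM !aug_geltB1 !mulr0 addr0.
Qed.

End Abstract.

Lemma Gamma_resolution :
  free_resolution (res_diff p q k) (@augmentation (Gamma p q k)).
Proof.
have periodic := exact_periodic (Gamma_SU p q k) (Gamma_S_expg_eq1 p0 q0 k0)
  (Gamma_U_expg_eq1 p0 q0 k0) (@fox_derivation p q k).
have E2 := Nsum_d2 (Gamma_S p q k) (Gamma_U p q k).
have E3 := Nsum_d3 (Gamma_S p q k) (Gamma_U p q k).
split.
- move=> m; exists (\row__ << m *g 1%g >>); rewrite /= /augmentation mxE.
  exact: augU.
- exact: exact_aug (@Gamma_ind p q k).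
case=> [|n] v; have [ex1 ex2 ex3] := periodic v.
  by rewrite /= /d2 E2; exact: ex1.
(* The row [v] sits in degree $n+2$: for odd [n] the outgoing differential is [d3] and the incoming
   one [d2], for even [n] the reverse. *)
rewrite /=; case: (odd n); rewrite /= /d2 /d3 E2 E3; [exact: ex3|exact: ex2].
Qed.

End Resolution.

Theorem theorem8p4 (p q k : nat) (hp : (1 <= p)%N) (hq : (1 <= q)%N)
    (hk : (1 <= k)%N) (hpq : gcdn p q = 1%N) :
  [/\ torus_a p q ^+ (k * p) <> 1,
      central (torus_a p q ^+ (k * p)),
      exists f : {multiplicative Gamma p q k -> SU_group p q k},
        [/\ bijective f, f (Gamma_S p q k) = SU_S p q k
          & f (Gamma_U p q k) = SU_U p q k],
      exists g : {multiplicative SU_group p q k -> cyc_amalgam p q k},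
        [/\ bijective g, g (SU_S p q k) = cyc_amalgam_S p q k
          & g (SU_U p q k) = cyc_amalgam_U p q k]
    & free_resolution (res_diff p q k) (@augmentation (Gamma p q k))].
Proof.
split.
- by apply: torus_a_exp_neq1; rewrite // muln_gt0 hk.
- exact: torus_central.
- exact: Gamma_SU_iso.
- exact: SU_amalgam_iso.
- exact: Gamma_resolution.
Qed.
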